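(* Let $J\subset\mathbb N$, let $(X_i,\widetilde d_i)$, $i\in J$, be metric spaces with metrics bounded by $1$, and let $(X,d)=\prod_{i\in J}(X_i,\widetilde d_i)$. For each $i\in J$ let $G_i$ be a homeomorphism group of $X_i$. If there exists $n\in J$ such that $G_n$ is sensitive to initial conditions on $(X_n,\widetilde d_n)$, then the direct product of groups $G=\prod_{i\in J}G_i$ is also sensitive to initial conditions on $(X,d)$.
   Context: A homeomorphism group of $X$ is a group of homeomorphisms of $X$ onto itself. Here $\mathbb N=\{1,2,\dots\}$ and $J$ may be finite or infinite. The product metric space $(X,d)=\prod_{i\in J}(X_i,\widetilde d_i)$ is the Cartesian product $X=\prod_{i\in J}X_i$ with the metric $d(x,y)=\sum_{i\in J}\frac{1}{2^i}\widetilde d_i(x_i,y_i)$. (The metric $\widetilde d_i$ is obtained from an original metric $d_i$ on $X_i$ as $\widetilde d_i=d_i$ if $d_i$ is bounded by $1$, and $\widetilde d_i=\frac{d_i}{1+d_i}$ otherwise.) The group $G=\prod_i G_i$ acts canonically on $X$: $\{g_i\}.\{x_i\}=\{g_i.x_i\}$. A homeomorphism group $G$ of a metric space $(X,d)$ is sensitive to initial conditions if there exists $\delta>0$ such that for every nonempty open subset $U\subset X$ there exists $g\in G$ with $\operatorname{diam}(g.U)\ge\delta$. *)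

(* Defs.v *)
From HB Require Import structures.
From mathcomp Require Import all_boot all_order all_algebra.
From mathcomp Require Import all_classical all_reals all_analysis.
From mathcomp Require Import lra ring.

Set Implicit Arguments.
Unset Strict Implicit.
Unset Printing Implicit Defensive.

Import Order.TTheory GRing.Theory Num.Theory.
Import metricType_numDomainType.

Local Open Scope classical_set_scope.
Local Open Scope ring_scope.

Definition homeomorphism (T : topologicalType) (f : T -> T) : Prop :=
  exists g : T -> T, [/\ cancel f g, cancel g f, continuous f & continuous g].

Record homeo_group (T : topologicalType) := HomeoGroup {
  homeo_set :> (T -> T) -> Prop;
  homeo_groupP : forall f, homeo_set f -> homeomorphism f;
  homeo_group1 : homeo_set idfun;
  homeo_groupM : forall f g, homeo_set f -> homeo_set g -> homeo_set (f \o g);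
  homeo_groupV : forall f g, homeo_set f -> cancel f g -> cancel g f ->
    homeo_set g }.

(* The supremum is taken in \bar R, so that the diameter of an unbounded set is
   +oo; the diameter of set0 is -oo. *)
Definition diam (R : realType) (T : metricType R) (A : set T) : \bar R :=
  ereal_sup [set (mdist p.1 p.2)%:E | p in A `*` A].

Definition sensitive (R : realType) (T : metricType R) (G : homeo_group T) :
    Prop :=
  exists2 delta : R, 0 < delta &
    forall U : set T, open U -> U !=set0 ->
      exists2 g, G g & (delta%:E <= diam (g @` U))%E.

(* The bound on the metrics is a parameter of the type: without it the series
   defining the distance may diverge. *)
Definition metric_prod (R : realType) (J : set nat) (X : J -> metricType R)
  & (forall (i : J) (x y : X i), mdist x y <= 1) := forall i : J, X i.

Section metric_prod_metric.
Context (R : realType) (J : set nat) (X : J -> metricType R).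
Hypothesis bX : forall (i : J) (x y : X i), mdist x y <= 1.
Local Notation P := (metric_prod bX).

Definition prod_dist (x y : P) : R :=
  fine (\esum_(i in [set: J]) (2 ^- val i * mdist (x i) (y i))%:E).

Lemma weight_gt0 n : 0 < 2 ^- n :> R.
Proof. by rewrite invr_gt0 exprn_gt0. Qed.

Lemma esum_subset (T : choiceType) (A B : set T) (a : T -> \bar R) :
  A `<=` B -> (\esum_(i in A) a i <= \esum_(i in B) a i)%E.
Proof.
move=> AB; apply: ge_ereal_sup => _ [F [finF FA] <-].
by apply: ereal_sup_ubound; exists F => //; split=> //; exact: subset_trans AB.
Qed.

Lemma esum_weight_tail N (c : R) : 0 <= c ->
  (\esum_(i in [set i : J | (N <= val i)%N]) (2 ^- val i * c)%:E
    <= (2 * 2 ^- N * c)%:E)%E.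
Proof.
move=> c0; have w0 n : 0 <= 2 ^- n * c by rewrite mulr_ge0// ltW// weight_gt0.
have -> : (\esum_(i in [set i : J | (N <= val i)%N]) (2 ^- val i * c)%:E =
    \esum_(j in val @` [set i : J | (N <= val i)%N]) (2 ^- j * c)%:E)%E.
  by rewrite esum_image// => i j _ _; exact: val_inj.
apply: (@le_trans _ _ (\esum_(j in addn N @` [set: nat]) (2 ^- j * c)%:E)%E).
  apply: esum_subset => _ [i /= Ni <-]; exists (val i - N)%N => //.
  by rewrite subnKC.
rewrite esum_image; last by move=> i j _ _ /addnI.
rewrite -nneseries_esumT; last by move=> n; rewrite lee_fin.
apply: le_trans (@epsilon_trick0 R (2 * 2 ^- N * c) xpredT _); last first.
  by rewrite -mulrA mulr_ge0.
apply: lee_nneseries => [i _ _|i _]; first by rewrite lee_fin.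
rewrite lee_fin natrX exprD exprS !invfM.
by rewrite le_eqVlt; apply/orP; left; apply/eqP; field; rewrite !expf_neq0.
Qed.

Lemma prod_distE (x y : P) : (prod_dist x y)%:E =
  (\esum_(i in [set: J]) (2 ^- val i * mdist (x i) (y i))%:E)%E.
Proof.
rewrite /prod_dist fineK// fin_numElt; apply/andP; split.
  apply: (lt_le_trans (ltNyr 0)); apply: esum_ge0 => i _.
  by rewrite lee_fin mulr_ge0 ?mdist_ge0// ltW// weight_gt0.
apply: (@le_lt_trans _ _ (2 * 2 ^- 0 * 1 : R)%:E); last exact: ltry.
apply: (le_trans _ (esum_weight_tail 0 ler01)).
rewrite (_ : [set _ | _] = [set: J]); last exact/seteqP.
apply: le_esum => i _.
by rewrite lee_fin ler_wpM2l ?bX// ltW// weight_gt0.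
Qed.

Lemma prod_dist_ge (x y : P) (i : J) :
  2 ^- val i * mdist (x i) (y i) <= prod_dist x y.
Proof.
rewrite -lee_fin prod_distE.
have w0 (j : J) : 0 <= 2 ^- val j * mdist (x j) (y j).
  by rewrite mulr_ge0 ?mdist_ge0// ltW// weight_gt0.
rewrite -(@esum_set1 R J i (fun j => (2 ^- val j * mdist (x j) (y j))%:E)).
  exact: esum_subset.
by rewrite lee_fin.
Qed.

Lemma prod_distxx x : prod_dist x x = 0.
Proof.
by rewrite /prod_dist esum1// => i _; rewrite mdistxx mulr0.
Qed.

Lemma prod_dist_positivity x y : prod_dist x y = 0 -> x = y.
Proof.
move=> xy0; apply: functional_extensionality_dep => i.
apply: mdist_positivity; apply/eqP; rewrite eq_le mdist_ge0 andbT.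
have := prod_dist_ge x y i; rewrite xy0.
by rewrite pmulr_rle0// weight_gt0.
Qed.

Lemma prod_dist_sym x y : prod_dist x y = prod_dist y x.
Proof.
by rewrite /prod_dist; congr fine; apply: eq_esum => i _; rewrite metric_sym.
Qed.

Lemma prod_dist_triangle y x z :
  prod_dist x z <= prod_dist x y + prod_dist y z.
Proof.
have w0 (u v : P) (j : J) : (0 <= (2 ^- val j * mdist (u j) (v j))%:E)%E.
  by rewrite lee_fin mulr_ge0 ?mdist_ge0// ltW// weight_gt0.
rewrite -lee_fin EFinD !prod_distE -esumD//.
apply: le_esum => i _.
by rewrite -EFinD lee_fin -mulrDr ler_wpM2l ?metric_triangle// ltW// weight_gt0.
Qed.

HB.instance Definition _ := gen_eqMixin P.
HB.instance Definition _ := gen_choiceMixin P.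
HB.instance Definition _ := @isMetric.Build R P prod_dist
  prod_distxx prod_dist_positivity prod_dist_sym prod_dist_triangle.

Lemma metric_prodE (x y : P) : mdist x y =
  fine (\esum_(i in [set: J]) (2 ^- val i * mdist (x i) (y i))%:E).
Proof. by []. Qed.

Lemma metric_prod_proj_continuous (i : J) : continuous (fun x : P => x i).
Proof.
move=> x; apply/(@cvgrPdist_lt R (X i) P (nbhs x)) => e e0; apply/nbhs_ballP.
exists (2 ^- val i * e) => /= [|y]; first by rewrite mulr_gt0// weight_gt0.
rewrite ballEmdist/= => /(le_lt_trans (prod_dist_ge _ _ i)).
by rewrite ltr_pM2l// weight_gt0.
Qed.

Definition prod_act (g : forall i, X i -> X i) (x : P) : P :=
  fun i => g i (x i).

Lemma prod_act_continuous (g : forall i, X i -> X i) :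
  (forall i, continuous (g i)) -> continuous (prod_act g).
Proof.
move=> cg x; have FF : Filter (nbhs x) by exact: nbhs_filter.
apply/(@cvgrPdist_lt R P P (nbhs x)) => e e0.
have e8 : 0 < e / 8 by rewrite divr_gt0.
have [N _ /(_ N (leqnn N)) /= Ne] := near_infty_natSinv_expn_lt (PosNum e8).
have {}Ne : 2 ^- N < e / 8 by rewrite -[ltLHS]mul1r.
have : \forall y \near x, forall i : 'I_N, forall j : J, val j = i ->
    mdist (g j (x j)) (g j (y j)) < e / 8.
  apply: (@filter_forall P 'I_N (fun i y => forall j : J, val j = i ->
    mdist (g j (x j)) (g j (y j)) < e / 8) (nbhs x)) => i.
  have [Ji|nJi] := pselect (J i); last first.
    by apply: nearW => y j ji; exfalso; apply: nJi; rewrite -ji; exact: set_valP.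
  pose j0 : J := SigSub (mem_set Ji).
  have : \forall y \near x, mdist (g j0 (x j0)) (g j0 (y j0)) < e / 8.
    have gx : (fun y : P => g j0 (y j0)) y @[y --> x] --> g j0 (x j0).
      exact: (continuous_comp (@metric_prod_proj_continuous j0 x) (cg j0 (x j0))).
    exact: (@cvgr_dist_lt R (X j0) P (nbhs x) _ _ _ gx).
  apply: filterS => y xy j ji.
  by have -> : j = j0 by apply: val_inj.
apply: filterS => y xy.
rewrite -lte_fin [X in (X%:E < _)%E]/mdist/= prod_distE.
apply: (@le_lt_trans _ _ ((e / 4)%:E + (e / 4)%:E)%E); last first.
  by rewrite -EFinD lte_fin; lra.
have w0 (j : J) : 0 <= 2 ^- val j :> R by rewrite ltW// weight_gt0.
rewrite (esumID [set i : J | (N <= val i)%N]); last first.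
  by move=> j _; rewrite lee_fin mulr_ge0 ?mdist_ge0.
rewrite !setTI; apply: leeD.
  apply: (@le_trans _ _ (2 * 2 ^- N * 1)%:E); last by rewrite lee_fin; lra.
  apply: le_trans (esum_weight_tail N ler01); apply: le_esum => i _.
  by rewrite lee_fin ler_wpM2l ?bX.
apply: (@le_trans _ _ (2 * 2 ^- 0 * (e / 8))%:E); last by rewrite lee_fin; lra.
apply: le_trans (esum_weight_tail 0 (ltW e8)).
apply: (@le_trans _ _ (\esum_(i in ~` [set i : J | (N <= val i)%N])
  (2 ^- val i * (e / 8))%:E)%E); last exact: esum_subset.
apply: le_esum => i /= /negP; rewrite -ltnNge => iN.
by rewrite lee_fin ler_wpM2l// ltW//; exact: (xy (Ordinal iN)).
Qed.

Section prod_group.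
Variable G : forall i : J, homeo_group (X i).

Definition prod_homeo_set : set (P -> P) :=
  [set prod_act g | g in [set g : forall i, X i -> X i | forall i, G i (g i)]].

Lemma prod_homeo_setV g : (forall i, G i (g i)) ->
  exists2 k, (forall i, G i (k i)) &
    cancel (prod_act g) (prod_act k) /\ cancel (prod_act k) (prod_act g).
Proof.
move=> Gg.
have /(_ _)/cid kP i : exists k, [/\ G i k, cancel (g i) k & cancel k (g i)].
  have [k [gk kg _ _]] := homeo_groupP (Gg i).
  by exists k; split=> //; exact: (homeo_groupV (Gg i)).
exists (fun i => sval (kP i)) => [i|]; first by case: (kP i) => k [].
split=> x; apply: functional_extensionality_dep => i; rewrite /prod_act.
  by case: (kP i) => k [].
by case: (kP i) => k [].
Qed.

Lemma prod_homeo_groupP f : prod_homeo_set f -> homeomorphism f.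
Proof.
move=> [g /= Gg <-]; have [k Gk [gk kg]] := prod_homeo_setV Gg.
exists (prod_act k); split=> //; apply: prod_act_continuous => i.
  by have [? []] := homeo_groupP (Gg i).
by have [? []] := homeo_groupP (Gk i).
Qed.

Lemma prod_homeo_group1 : prod_homeo_set idfun.
Proof. by exists (fun i => idfun) => // i; exact: homeo_group1. Qed.

Lemma prod_homeo_groupM f g : prod_homeo_set f -> prod_homeo_set g ->
  prod_homeo_set (f \o g).
Proof.
move=> [f' /= Gf <-] [g' /= Gg <-]; exists (fun i => f' i \o g' i) => //= i.
exact: homeo_groupM.
Qed.

Lemma prod_homeo_groupV f g : prod_homeo_set f -> cancel f g -> cancel g f ->
  prod_homeo_set g.
Proof.
move=> [f' /= Gf <-] fg gf; have [k Gk [fk kf]] := prod_homeo_setV Gf.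
exists k => //; apply/funext => x.
by rewrite -[in LHS](gf x) fk.
Qed.

(* The direct product of the groups G i, as the group of transformations
   x |-> (g_i x_i)_i of the product space. *)
Definition prod_homeo_group : homeo_group P :=
  HomeoGroup prod_homeo_groupP prod_homeo_group1 prod_homeo_groupM
    prod_homeo_groupV.

End prod_group.
End metric_prod_metric.

(* Main.v *)
(** Freezing all coordinates but the n-th at those of a point of [U] embeds an
    open piece [V] of [X n] into [U]; an element of [G n] stretching [V],
    extended by the identity on the other coordinates, stretches [U] by at
    least [2 ^- n] times as much. *)
Require Import Defs.
From mathcomp Require Import all_boot all_order all_algebra.
From mathcomp Require Import all_classical all_reals all_analysis.

Import Order.TTheory GRing.Theory Num.Theory.
Import metricType_numDomainType.

Local Open Scope classical_set_scope.
Local Open Scope ring_scope.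

(** The two points agree off [n], so every other term of the series vanishes. *)
Lemma mdist_dfwith (R : realType) (J : set nat) (X : J -> metricType R)
    (bX : forall (i : J) (x y : X i), mdist x y <= 1)
    (x : metric_prod bX) (n : J) (z z' : X n) :
  mdist (dfwith x n z : metric_prod bX) (dfwith x n z' : metric_prod bX) =
  2 ^- val n * mdist z z'.
Proof.
have w0 (u v : metric_prod bX) (j : J) :
    (0 <= (2 ^- val j * mdist (u j) (v j))%:E)%E.
  by rewrite lee_fin mulr_ge0 ?mdist_ge0// ltW// weight_gt0.
apply: EFin_inj; rewrite [X in X%:E = _]/mdist/= prod_distE.
rewrite (esumID [set n])// !setTI esum_set1// esum1 ?adde0 ?dfwithin//.
by move=> j /= /eqP; rewrite eq_sym => nj; rewrite !dfwithout// mdistxx mulr0.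
Qed.

Lemma dfwith_metric_prod_continuous (R : realType) (J : set nat)
    (X : J -> metricType R)
    (bX : forall (i : J) (x y : X i), mdist x y <= 1)
    (x : metric_prod bX) (n : J) :
  continuous (fun z : X n => dfwith x n z : metric_prod bX).
Proof.
move=> z; apply/(@cvgrPdist_lt R (metric_prod bX) (X n) (nbhs z)) => e e0.
(* The embedding scales distances by exactly [2 ^- val n], hence this radius. *)
apply/nbhs_ballP; exists (2 ^+ val n * e) => /= [|z'].
  by rewrite mulr_gt0// exprn_gt0.
by rewrite ballEmdist/= mdist_dfwith ltr_pdivrMl// exprn_gt0.
Qed.

(** Points of the slice of [U] through [x] lift to points of [U], and the [n]-th term alone bounds
    the distance of their images from below. *)
Lemma le_diam_prod_act (R : realType) (J : set nat) (X : J -> metricType R)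
    (bX : forall (i : J) (x y : X i), mdist x y <= 1)
    (g : forall i, X i -> X i) (x : metric_prod bX) (n : J)
    (U : set (metric_prod bX)) :
  ((2 ^- val n)%:E * diam (g n @` [set z | U (dfwith x n z)]) <=
    diam (prod_act (bX := bX) g @` U))%E.
Proof.
(* Moving the weight to the right leaves a bare supremum, which is bounded element by element; the
   weight then moves back. *)
rewrite lee_pdivrMl ?exprn_gt0//.
apply: ge_ereal_sup => _ [_ [[z Uz <-] [z' Uz' <-]] <-] /=.
rewrite -lee_pdivrMl ?exprn_gt0// -EFinM.
apply: (@le_trans _ _ (mdist (prod_act g (dfwith x n z : metric_prod bX))
    (prod_act g (dfwith x n z' : metric_prod bX)))%:E).
  rewrite lee_fin; apply: le_trans (prod_dist_ge _ _ n).
  by rewrite /prod_act !dfwithin.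
apply: ereal_sup_ubound; exists (prod_act g (dfwith x n z : metric_prod bX),
  prod_act g (dfwith x n z' : metric_prod bX)) => //.
by split; [exists (dfwith x n z)|exists (dfwith x n z')].
Qed.

Theorem theorem6p15 (R : realType) (J : set nat)
    (hJ : J `<=` [set i | (1 <= i)%N])
    (X : J -> metricType R)
    (bX : forall (i : J) (x y : X i), mdist x y <= 1)
    (G : forall i : J, homeo_group (X i)) :
  (exists n : J, sensitive (G n)) -> sensitive (prod_homeo_group bX G).
Proof.
move=> [n [delta delta0 Gn]].
(* The constant depends on [n] only, not on [U] or on the base point [x]. *)
exists (2 ^- val n * delta) => [|U oU [x Ux]].
  by rewrite mulr_gt0// weight_gt0.
have [||gn Ggn dgn] := Gn [set z | U (dfwith x n z)].
- apply: (@open_comp _ _ (fun z : X n => dfwith x n z : metric_prod bX)) => //.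
  by move=> z _; exact: dfwith_metric_prod_continuous.
(* The slice is nonempty: resetting the [n]-th coordinate of [x] to its own value gives back [x], a
   point of [U]. *)
- exists (x n) => /=; rewrite (_ : dfwith x n (x n) = x)//.
  apply: functional_extensionality_dep => j.
  by have [<-|nj] := eqVneq n j; rewrite ?dfwithin ?dfwithout.
pose g : forall i, X i -> X i := dfwith (fun i => idfun) n gn.
have gE : g n = gn by rewrite /g dfwithin.
exists (prod_act g).
  exists g => //= j; have [<-|nj] := eqVneq n j; first by rewrite gE.
  by rewrite /g dfwithout//; exact: homeo_group1.
apply: le_trans (le_diam_prod_act _ _ _ _ g x n U).
by rewrite gE EFinM lee_pmul2l// lte_fin weight_gt0.
Qed.
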